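(* Let $N\ge1$, let $U$ be an $N\times N$ unitary matrix, and let $\rho$ be an $N\times N$ density matrix with eigenvalues $\lambda_1\ge\dots\ge\lambda_N$ (set $\lambda_j=0$ for $N<j\le 2N$). Let $p_i=\langle i|\rho|i\rangle$ and $q_i=\langle i|U^\dagger\rho U|i\rangle$ for $i=1,\dots,N$, and let $W^{(\lambda)}\in\mathbb{R}^{2N}$ be the vector defined below. Then: (a) $H(p)+H(q)\ge-\sum_{i=1}^{2N}W^{(\lambda)}_i\ln W^{(\lambda)}_i$; (b) for every $\alpha$ with $0\le\alpha<1$, $H_\alpha(p)+H_\alpha(q)\ge\frac{1}{1-\alpha}\ln\Big(\sum_{i=1}^{2N}\big(W^{(\lambda)}_i\big)^{\alpha}-1\Big)$; (c) for every $\alpha\ge0$, $T_\alpha(p)+T_\alpha(q)\ge\frac{1}{1-\alpha}\Big(\sum_{i=1}^{2N}\big(W^{(\lambda)}_i\big)^{\alpha}-2\Big)$ (for $\alpha=1$ interpreted as the limit $\alpha\to1$, i.e. statement (a)).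
   Context: For $k=1,\dots,2N-1$ let $s_k=\max\{\|M\| : M \text{ a submatrix of } U,\ \#\mathrm{rows}(M)+\#\mathrm{cols}(M)=k+1\}$ with $\|\cdot\|$ the operator norm. For $k=1,\dots,2N$: if $k=2n$, $S_k=\sum_{j=1}^{n}\lambda_j(1+s_{k-j})+\sum_{j=n+1}^{k}\lambda_j(1-s_{j-1})$; if $k=2n+1$ ($n\ge0$), $S_k=\sum_{j=1}^{n}\lambda_j(1+s_{k-j})+\lambda_{n+1}+\sum_{j=n+2}^{k}\lambda_j(1-s_{j-1})$. Set $S_0=0$ and $W^{(\lambda)}_k=S_k-S_{k-1}$. Entropies of a probability vector $p$: Shannon $H(p)=-\sum_i p_i\ln p_i$; Rényi $H_\alpha(p)=\frac{1}{1-\alpha}\ln\sum_i p_i^\alpha$; Tsallis $T_\alpha(p)=\frac{1}{1-\alpha}(\sum_i p_i^\alpha-1)$; conventions $0\ln0=0$ and, for $\alpha=0$, $0^0=0$ (sums run over nonzero entries). *)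

(* Defs.v *)
From HB Require Import structures.
From mathcomp Require Import all_boot all_order all_algebra.
From mathcomp Require Import complex.
From mathcomp Require Import classical_sets reals exp.
Set Implicit Arguments. Unset Strict Implicit. Unset Printing Implicit Defensive.
Import Order.TTheory GRing.Theory Num.Theory.
Local Open Scope ring_scope.

Section Defs.
Variable R : realType.
Local Notation C := R[i].

Definition adj m n (A : 'M[C]_(m, n)) : 'M[C]_(n, m) := (map_mx Num.conj A)^T.

Definition unitary n (U : 'M[C]_n) : Prop := U *m adj U = 1%:M.

Definition hermitian n (A : 'M[C]_n) : Prop := adj A = A.

Definition psd n (A : 'M[C]_n) : Prop :=
  forall v : 'cV[C]_n, 0 <= (adj v *m A *m v) 0 0.

Definition density_matrix n (A : 'M[C]_n) : Prop :=
  [/\ hermitian A, psd A & \tr A = 1].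

Definition eigenvalues_sorted n (A : 'M[C]_n) (lam : 'I_n -> R) : Prop :=
  char_poly A = \prod_(j < n) ('X - ((lam j)%:C)%C%:P) /\
  (forall i j : 'I_n, (i <= j)%N -> lam j <= lam i).

Definition vnorm n (v : 'cV[C]_n) : R :=
  Num.sqrt (\sum_i (complex.Re (v i 0) ^+ 2 + complex.Im (v i 0) ^+ 2)).

Definition opnorm m n (M : 'M[C]_(m, n)) : R :=
  sup [set vnorm (M *m v) | v in [set v : 'cV[C]_n | vnorm v <= 1]].

Definition s_coef n (U : 'M[C]_n) (k : nat) : R :=
  sup [set x | exists (r c : nat) (f : 'I_r -> 'I_n) (g : 'I_c -> 'I_n),
           [/\ injective f, injective g, (r + c)%N = k.+1 &
               x = opnorm (mxsub f g U)]].

(* lambda_j with 1-based index j, and lambda_j = 0 for j > n *)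
Definition lamx n (lam : 'I_n -> R) (j : nat) : R :=
  match insub j.-1 with
  | Some i => if (1 <= j)%N then lam i else 0
  | None => 0
  end.

Definition S_coef n (U : 'M[C]_n) (lam : 'I_n -> R) (k : nat) : R :=
  let s := s_coef U in
  let l := lamx lam in
  let m := k./2 in
  if k == 0%N then 0 else
  if ~~ odd k then
    \sum_(1 <= j < m.+1) l j * (1 + s (k - j)%N)
    + \sum_(m.+1 <= j < k.+1) l j * (1 - s j.-1)
  else
    \sum_(1 <= j < m.+1) l j * (1 + s (k - j)%N)
    + l m.+1
    + \sum_(m.+2 <= j < k.+1) l j * (1 - s j.-1).

(* W^(lambda) in R^{2n}, component i : 'I_(2n) is W_{i+1} = S_{i+1} - S_i *)
Definition W_vec n (U : 'M[C]_n) (lam : 'I_n -> R) : 'I_(n + n) -> R :=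
  fun i => S_coef U lam i.+1 - S_coef U lam i.

(* entropies, with 0 ln 0 = 0 and sums over nonzero entries *)
Definition shannon m (p : 'I_m -> R) : R :=
  - \sum_(i | p i != 0) p i * ln (p i).

Definition powsum m (a : R) (p : 'I_m -> R) : R :=
  \sum_(i | p i != 0) powR (p i) a.

Definition renyi m (a : R) (p : 'I_m -> R) : R :=
  (1 - a)^-1 * ln (powsum a p).

Definition tsallis m (a : R) (p : 'I_m -> R) : R :=
  (1 - a)^-1 * (powsum a p - 1).

Definition diag_probs n (A : 'M[C]_n) : 'I_n -> R :=
  fun i => complex.Re (A i i).

End Defs.

(* Main.v *)
Require Import Defs.
From HB Require Import structures.
From mathcomp Require Import all_boot all_order all_algebra.
From mathcomp Require Import complex.
From mathcomp Require Import classical_sets reals exp.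
From mathcomp Require Import sequences.
From mathcomp Require Import perm ring lra zify spectral.
Import Order.TTheory GRing.Theory Num.Theory.
Local Open Scope ring_scope.

(** Put A = [1 U] ([frame]), an N by 2N matrix. The entries of p and q together ([joint_probs]) are
    the diagonal of A† rho A. The core claim is a majorization: any k of these 2N numbers sum to at
    most S_k, and all of them sum to 2 = S_{2N} ([joint_probs_le], [S_coef_total]). Since the prefix
    sums of W are the S_k, [karamata_tangent] compares the sums of a concave function over the two
    vectors. The choice -x ln x gives (a), x^a and -x^a give (c) for a < 1 and a > 1, and (b)
    follows from P + Q - 1 <= P Q for P, Q >= 1.

    To bound the sum over a set S of k positions, write rho = V† diag(lam) V. The sum is then sum_j
    lam_j h_j, where h_j is the squared mass on S of row j of V A. Summation by parts gives the
    weights lam_m - lam_{m+1} >= 0 to the partial sums h_1 + ... + h_m, so it suffices to bound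
    these ([ky_fan_le]). By Ky Fan's principle such a sum is at most the sum of the m largest
    eigenvalues of the Gram matrix of the columns of A in S, which is 1 plus the compression to S of
    the Hermitian matrix [coupling] with off-diagonal blocks U and U†. That compression has a
    submatrix M of U as its off-diagonal block, so its quadratic form is at most the norm of M,
    hence at most s_{k-1} ([qform_le]). Spending one coordinate of S per orthonormal direction
    bounds m directions by s_{k-1} + ... + s_{k-m} ([qform_sum_le]). Sign symmetry and zero trace
    cut this to min(m, k-m) terms ([qform_partial_le]). The increments of the resulting bound in m
    are exactly the coefficients of the lam_j in S_k ([ky_fan_bound_step]), so the bounds reassemble
    into S_k. No eigenvalue of the compression is ever named: unitary rotations from [lq_factor]
    replace them. *)

(** * Summation by parts and Karamata's inequality *)

Lemma abel_sum (R : pzRingType) (l d : nat -> R) (M : nat) :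
  \sum_(j < M) l j * d j =
  \sum_(j < M) (l j - l j.+1) * (\sum_(i < j.+1) d i) + l M * \sum_(i < M) d i.
Proof.
elim: M => [|M IH]; first by rewrite !big_ord0 mulr0 addr0.
rewrite big_ord_recr /= IH [in RHS]big_ord_recr /= -!addrA; congr (_ + _).
by rewrite mulrBl subrK big_ord_recr /= mulrDr.
Qed.

                                                                                
                                                                                       
                             
(** Karamata's inequality for a concave [phi] given by its tangent lines. Tangents are assumed only
    at positive points because the slopes of -x ln x and x^a blow up at 0. Majorization is stated
    over all subsets, so only [x] has to be sorted; [v] enters through its prefix sums alone. *)
Lemma karamata_tangent (R : realDomainType) (phi dphi : R -> R) (T : finType)
    (x : T -> R) (v : nat -> R) :
  (forall a b, 0 < a -> 0 <= b -> phi b <= phi a + dphi a * (b - a)) ->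
  phi 0 = 0 -> (forall i, 0 <= x i) -> (forall j, (j < #|T|)%N -> 0 <= v j) ->
  (forall S : {set T}, \sum_(i in S) x i <= \sum_(j < #|S|) v j) ->
  \sum_i x i = \sum_(j < #|T|) v j ->
  \sum_(j < #|T|) phi (v j) <= \sum_i phi (x i).
Proof.
move=> tangent phi0 x_ge0 v_ge0 maj tot.
(* Only the positive entries of [x] are sorted, in decreasing order, since tangents exist only
   there; the others contribute [phi 0 = 0]. *)
pose P := [set i | 0 < x i]; pose r := relpre x >=%R.
pose s := sort r (enum P); pose t := #|P|.
pose y j := nth 0 (map x s) j.
have r_tr : transitive r by move=> a b c /= ab /le_trans; apply.
have s_sorted : sorted r s by apply: sort_sorted => a b; exact: le_total.
have perm_s : perm_eq s (enum P) by rewrite /s perm_sort.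
have size_s : size s = t by rewrite size_sort -cardE.
have uniq_s : uniq s by rewrite sort_uniq enum_uniq.
have le_tM : (t <= #|T|)%N by exact: max_card.
have y_gt0 j : (j < t)%N -> 0 < y j.
  move=> jt; have /mapP[i i_s ->] : y j \in map x s.
    by apply: mem_nth; rewrite size_map size_s.
  by move: i_s; rewrite (perm_mem perm_s) mem_enum inE.
have sum_y (f : R -> R) (k : nat) : (k <= t)%N ->
    \sum_(j < k) f (y j) = \sum_(i <- take k s) f (x i).
  move=> kt; have sz : size (map x (take k s)) = k by rewrite size_map size_takel ?size_s.
  rewrite -(big_map x xpredT f) (big_nth 0) sz big_mkord.
  by apply: eq_bigr => j _; rewrite /y map_take nth_take.
have sumP (f : R -> R) : f 0 = 0 -> \sum_i f (x i) = \sum_(j < t) f (y j).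
  move=> f0; rewrite sum_y // -size_s take_size (perm_big _ perm_s) /= big_enum /=.
  rewrite (bigID (mem P)) /= [X in _ + X]big1 ?addr0 // => i; rewrite inE -leNgt => xi.
  by rewrite (le_anti (introT andP (conj xi (x_ge0 i)))).
have part_maj k : (k <= t)%N -> \sum_(j < k) y j <= \sum_(j < k) v j.
  move=> kt; have := maj [set i in take k s].
  have uk : uniq (take k s) by rewrite take_uniq.
  rewrite cardsE (card_uniqP uk) size_takel ?size_s // => le1; apply: le_trans le1.
  rewrite (sum_y id) // (big_uniq _ uk) /= le_eqVlt; apply/orP; left; apply/eqP.
  by apply: eq_bigl => i; rewrite inE.
have split_v (f : R -> R) : \sum_(j < #|T|) f (v j) =
    \sum_(j < t) f (v j) + \sum_(t <= j < #|T|) f (v j).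
  by rewrite -!(big_mkord xpredT (fun j => f (v j))) -big_cat_nat.
have tail_ge0 : 0 <= \sum_(t <= j < #|T|) v j.
  by rewrite big_nat_cond; apply: sumr_ge0 => j /andP[/andP[_ ?] _]; apply: v_ge0.
have := part_maj t (leqnn _).
have := sumP id erefl; rewrite tot (split_v id) /= => tot_y le_y.
(* The first [t] entries of [v] already reach the common total, so the nonnegative remainder
   vanishes and [phi] is 0 on it. *)
have tail0 : \sum_(t <= j < #|T|) v j = 0 by apply/le_anti; rewrite tail_ge0 andbT; lra.
have tot_t : \sum_(j < t) (v j - y j) = 0 by rewrite sumrB -tot_y tail0; ring.
have phi_tail : \sum_(t <= j < #|T|) phi (v j) = 0.
  rewrite big_nat_cond big1 // => j /andP[/andP[tj jM] _].
  have -> : v j = 0; last exact: phi0.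
  apply/eqP; move/eqP: tail0; rewrite big_nat_cond psumr_eq0; last first.
    by move=> i /andP[/andP[_ ?] _]; apply: v_ge0.
  by move/allP => /(_ j); rewrite mem_index_iota tj jM /= => /(_ isT).
rewrite split_v phi_tail addr0 sumP // -subr_ge0 -sumrB.
have y_mono j : (j.+1 < t)%N -> y j.+1 <= y j.
  move=> jt; rewrite /y; have i0 : T by case: (s) size_s jt => [<-|i].
  rewrite !(nth_map i0) ?size_s //; last exact: ltnW.
  by have /(sortedP i0)/(_ j) := s_sorted; rewrite size_s => /(_ jt).
have dphi_mono j : (j.+1 < t)%N -> dphi (y j) <= dphi (y j.+1).
  move=> jt; have yj := y_gt0 _ (ltnW jt); have yj1 := y_gt0 _ jt.
  have [eq_y|ne_y] := eqVneq (y j.+1) (y j); first by rewrite eq_y.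
  have lt_y : y j.+1 < y j by rewrite lt_neqAle ne_y y_mono.
  have t1 := tangent _ _ yj (ltW yj1); have t2 := tangent _ _ yj1 (ltW yj).
  (* Adding the tangent inequalities taken at each of the two points and evaluated at the other
     shows that slopes decrease. *)
  rewrite -(ler_pM2r (_ : 0 < y j - y j.+1)); last by rewrite subr_gt0.
  by rewrite -subr_ge0; nra.
(* Summation by parts: increments of [- dphi (y j)] are signed by [dphi_mono], partial sums of
   [v - y] by [part_maj], and the boundary term is zero. *)
have : 0 <= \sum_(j < t) - dphi (y j) * (v j - y j).
  rewrite (abel_sum _ (fun j => - dphi (y j)) (fun j => v j - y j)) tot_t mulr0 addr0.
  apply: sumr_ge0 => -[j /= jt] _.
  have [jt1|] := ltnP j.+1 t; last first.
    move=> tj; have <- : t = j.+1 by apply/anti_leq; rewrite tj jt.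
    by rewrite tot_t mulr0.
  rewrite mulr_ge0 //; first by have := dphi_mono _ jt1; lra.
  by rewrite sumrB subr_ge0 part_maj // ltnW.
move/le_trans; apply; apply: ler_sum => j _.
have vj : 0 <= v j by apply: v_ge0; apply: leq_trans le_tM.
by have := tangent _ _ (y_gt0 j (ltn_ord j)) vj; lra.
Qed.

(** * Tangent-line inequalities for the entropy functions *)

Section Tangents.
Context {R : realType}.

Definition pow_term (a x : R) : R := if x != 0 then x `^ a else 0.
Definition ent_term (x : R) : R := if x != 0 then - (x * ln x) else 0.

Lemma ent_term_tangent (x w : R) : 0 < x -> 0 <= w ->
  ent_term w <= ent_term x + - (ln x + 1) * (w - x).
Proof.
move=> x0; rewrite le_eqVlt /ent_term (gt_eqF x0) /= => /predU1P[<-|w0].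
  by rewrite eqxx /=; lra.
rewrite (gt_eqF w0) /=.
have : w * ln (x / w) <= w * (x / w - 1).
  rewrite ler_pM2l //; have := @le_ln1Dx R (x / w - 1).
  by rewrite addrCA subrr addr0; apply; rewrite ltrBDr addrC subrr divr_gt0.
have -> : w * (x / w - 1) = x - w by field; rewrite gt_eqF.
by rewrite ln_div ?posrE //; lra.
Qed.

(** With t = e^s and y = e^(a s), both t = y e^((1-a) s) and 1 = y e^(-a s) are bounded below by 1 +
    u <= e^u. Weighting them by a and 1 - a cancels the terms in s. *)
Lemma powR_le_tangent1 (a t : R) : 0 <= a <= 1 -> 0 < t ->
  t `^ a <= 1 + a * (t - 1).
Proof.
move=> /andP[a0 a1] t0; rewrite /powR gt_eqF //.
have {1}-> : t = expR (ln t) by rewrite lnK.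
rewrite lnK ?posrE //; set s := ln t; set y := expR (a * s).
have ty : t = y * expR ((1 - a) * s).
  by rewrite -expRD -mulrDl addrCA subrr addr0 mul1r lnK.
have y1 : 1 = y * expR (- (a * s)) by rewrite -expRD subrr expR0.
have e1 := ler_wpM2l (expR_ge0 (a * s)) (expR_ge1Dx ((1 - a) * s)).
have e2 := ler_wpM2l (expR_ge0 (a * s)) (expR_ge1Dx (- (a * s))).
rewrite -/y -ty in e1; rewrite -/y -y1 in e2.
have b1 : 0 <= 1 - a by lra.
have f1 := ler_wpM2l a0 e1; have f2 := ler_wpM2l b1 e2.
by apply: le_trans (_ : (1 - a) * 1 + a * t <= _); lra.
Qed.

(** Bernoulli's inequality: t^a = t e^((a-1) s) >= t (1 + (a-1) s) with s = ln t, and t s >= t -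
    1. *)
Lemma powR_ge_tangent1 (a t : R) : 1 <= a -> 0 < t ->
  1 + a * (t - 1) <= t `^ a.
Proof.
move=> a1 t0; rewrite /powR gt_eqF //; set s := ln t.
have b0 : 0 <= a - 1 by lra.
have -> : expR (a * s) = t * expR ((a - 1) * s).
  by rewrite -{1}[t]lnK ?posrE // -expRD -/s; congr expR; ring.
have e1 := ler_wpM2l (ltW t0) (expR_ge1Dx ((a - 1) * s)).
have e2 := ler_wpM2l (ltW t0) (expR_ge1Dx (- s)).
rewrite expRN lnK // divff ?gt_eqF // in e2.
by have := ler_wpM2l b0 e2; lra.
Qed.

Lemma powR_shift (a x w : R) : 0 < x -> 0 < w -> w `^ a = x `^ a * (w / x) `^ a.
Proof.
move=> x0 w0; rewrite -powRM ?ltW ?divr_gt0 //.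
by rewrite mulrCA divff ?gt_eqF // mulr1.
Qed.

Lemma pow_term_tangent_lt1 (a x w : R) : 0 <= a <= 1 -> 0 < x -> 0 <= w ->
  pow_term a w <= pow_term a x + (a * x `^ a / x) * (w - x).
Proof.
move=> a01 x0; have [a0 a1] := andP a01.
have xa := powR_ge0 x a.
have xx (z : R) : z / x * x = z by rewrite divfK ?gt_eqF.
rewrite le_eqVlt /pow_term (gt_eqF x0) /= => /predU1P[<-|w0].
  rewrite eqxx /= sub0r mulrN xx; have : 0 <= (1 - a) * x `^ a by apply: mulr_ge0; lra.
  lra.
rewrite (gt_eqF w0) /= (powR_shift a x w) //.
have := ler_wpM2l xa (powR_le_tangent1 a (w / x) a01 (divr_gt0 w0 x0)).
move/le_trans; apply; rewrite le_eqVlt; apply/orP; left; apply/eqP.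
by field; rewrite gt_eqF.
Qed.

Lemma pow_term_tangent_gt1 (a x w : R) : 1 <= a -> 0 < x -> 0 <= w ->
  - pow_term a w <= - pow_term a x + - (a * x `^ a / x) * (w - x).
Proof.
move=> a1 x0; have xa := powR_ge0 x a.
have xx (z : R) : z / x * x = z by rewrite divfK ?gt_eqF.
rewrite le_eqVlt /pow_term (gt_eqF x0) /= => /predU1P[<-|w0].
  rewrite eqxx /= sub0r mulrNN xx oppr0; have : 0 <= (a - 1) * x `^ a by apply: mulr_ge0; lra.
  lra.
rewrite (gt_eqF w0) /= (powR_shift a x w) //.
have := ler_wpM2l xa (powR_ge_tangent1 a (w / x) a1 (divr_gt0 w0 x0)).
rewrite -lerN2; move/le_trans; apply; rewrite le_eqVlt; apply/orP; left; apply/eqP.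
by field; rewrite gt_eqF.
Qed.

End Tangents.

(** * Operator norms of submatrices and the coefficients s_k *)

Section Norms.
Context {R : realType}.
Local Notation C := R[i].

Definition nsq (z : C) : R := complex.Re z ^+ 2 + complex.Im z ^+ 2.
Definition vsq {n} (v : 'cV[C]_n) : R := \sum_i nsq (v i 0).

Lemma ReD (x y : C) : complex.Re (x + y) = complex.Re x + complex.Re y.
Proof. by case: x y => [a b] [c d]. Qed.

Lemma ReN (x : C) : complex.Re (- x) = - complex.Re x.
Proof. by case: x. Qed.

Lemma Re_sum (I : Type) (r : seq I) (P : pred I) (F : I -> C) :
  complex.Re (\sum_(i <- r | P i) F i) = \sum_(i <- r | P i) complex.Re (F i).
Proof. by apply: (big_morph (@complex.Re R)) => //; apply: ReD. Qed.

Lemma nsq_ge0 (z : C) : 0 <= nsq z.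
Proof. by rewrite addr_ge0 ?sqr_ge0. Qed.

Lemma nsq0 : nsq 0 = 0.
Proof. by rewrite /nsq /= expr0n /= addr0. Qed.

Lemma nsqE (z : C) : nsq z = complex.Re (z * Num.conj z).
Proof. by case: z => a b; rewrite /nsq /=; ring. Qed.

Lemma nsq_conj (z : C) : nsq (Num.conj z) = nsq z.
Proof. by case: z => a b; rewrite /nsq /=; ring. Qed.

Lemma nsqMr (x : R) (z : C) : nsq (x%:C%C * z) = x ^+ 2 * nsq z.
Proof. by case: z => a b; rewrite /nsq /=; ring. Qed.

Lemma adjM m n p (A : 'M[C]_(m, n)) (B : 'M[C]_(n, p)) :
  adj (A *m B) = adj B *m adj A.
Proof. by rewrite /adj map_mxM trmx_mul. Qed.

Lemma adjK m n (A : 'M[C]_(m, n)) : adj (adj A) = A.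
Proof. by apply/matrixP => i j; rewrite !mxE conjCK. Qed.

Lemma adj1 n : adj (1%:M : 'M[C]_n) = 1%:M.
Proof. by rewrite /adj map_mx1 trmx1. Qed.

Lemma vsq_ge0 n (v : 'cV[C]_n) : 0 <= vsq v.
Proof. by apply: sumr_ge0 => i _; apply: nsq_ge0. Qed.

Lemma vsqE n (v : 'cV[C]_n) : vsq v = complex.Re ((adj v *m v) 0 0).
Proof.
rewrite mxE Re_sum; apply: eq_bigr => i _.
by rewrite !mxE nsqE mulrC.
Qed.

Lemma vnorm_sqr n (v : 'cV[C]_n) : vnorm v ^+ 2 = vsq v.
Proof. by rewrite sqr_sqrtr // vsq_ge0. Qed.

Lemma vnorm_ge0 n (v : 'cV[C]_n) : 0 <= vnorm v.
Proof. exact: sqrtr_ge0. Qed.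

Lemma vnorm0 n : vnorm (0 : 'cV[C]_n) = 0.
Proof. by rewrite /vnorm big1 ?sqrtr0 // => i _; rewrite mxE /= expr0n /= addr0. Qed.

Lemma vsqZ n (x : R) (v : 'cV[C]_n) : vsq (x%:C%C *: v) = x ^+ 2 * vsq v.
Proof. by rewrite /vsq mulr_sumr; apply: eq_bigr => i _; rewrite mxE nsqMr. Qed.

Lemma vsq_isometry m n (A : 'M[C]_(m, n)) (v : 'cV[C]_n) :
  adj A *m A = 1%:M -> vsq (A *m v) = vsq v.
Proof. by move=> A1; rewrite !vsqE adjM mulmxA -(mulmxA _ (adj A)) A1 mulmx1. Qed.

(** This supplies the boundedness that makes the supremum in [opnorm] meaningful. *)
Definition contraction {m n} (M : 'M[C]_(m, n)) :=
  forall v, vsq (M *m v) <= vsq v.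

Lemma opnorm_ub m n (M : 'M[C]_(m, n)) : contraction M ->
  has_ubound [set vnorm (M *m v) | v in [set v : 'cV[C]_n | vnorm v <= 1]].
Proof.
move=> cM; exists 1 => _ [v /= v1 <-].
rewrite -(expr_le1 (n := 2)) ?vnorm_ge0 // vnorm_sqr; apply: le_trans (cM v) _.
by rewrite -vnorm_sqr expr_le1 // vnorm_ge0.
Qed.

Lemma opnorm_ge m n (M : 'M[C]_(m, n)) v : contraction M -> vnorm v <= 1 ->
  vnorm (M *m v) <= opnorm M.
Proof. by move=> cM v1; apply: (ub_le_sup (opnorm_ub m n M cM)); exists v. Qed.

Lemma opnorm_ge0 m n (M : 'M[C]_(m, n)) : contraction M -> 0 <= opnorm M.
Proof.
by move=> cM; have := opnorm_ge m n M 0 cM; rewrite mulmx0 !vnorm0; apply.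
Qed.

Lemma opnorm_le m n (M : 'M[C]_(m, n)) (c : R) :
  (forall v, vnorm v <= 1 -> vnorm (M *m v) <= c) -> opnorm M <= c.
Proof.
move=> Mc; apply: ge_sup; last by move=> _ [v /= v1 <-]; apply: Mc.
by exists (vnorm (M *m 0)); exists 0; rewrite //= vnorm0.
Qed.

Lemma opnorm_bound m n (M : 'M[C]_(m, n)) v : contraction M ->
  vsq (M *m v) <= opnorm M ^+ 2 * vsq v.
Proof.
move=> cM; have [v0|nv0] := eqVneq (vnorm v) 0.
  have := cM v; rewrite -(vnorm_sqr n) v0 expr0n /=.
  by rewrite mulr0.
have v_gt0 : 0 < vnorm v by rewrite lt_neqAle eq_sym nv0 vnorm_ge0.
have vE : v = (vnorm v)%:C%C *: ((vnorm v)^-1%:C%C *: v).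
  by rewrite scalerA -rmorphM divff // scale1r.
rewrite {1}vE -scalemxAr vsqZ mulrC -(vnorm_sqr n).
rewrite ler_pM2r ?exprn_gt0 // -vnorm_sqr ler_pXn2r ?nnegrE ?vnorm_ge0 ?opnorm_ge0 //.
apply: opnorm_ge => //; rewrite -(expr_le1 (n := 2)) ?vnorm_ge0 // vnorm_sqr.
by rewrite vsqZ -vnorm_sqr -exprMn mulVf // expr1n.
Qed.

Lemma le_sum_inj (I J : finType) (f : I -> J) (F : J -> R) : injective f ->
  (forall j, 0 <= F j) -> \sum_i F (f i) <= \sum_j F j.
Proof.
move=> f_inj F_ge0; rewrite -(big_imset F (A := predT)) /=; last by move=> ? ? _ _ /f_inj.
rewrite [leRHS](bigID (mem (f @: predT))) /= lerDl; exact: sumr_ge0.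
Qed.

Lemma colsub_isometry m n p (A : 'M[C]_(m, n)) (g : 'I_p -> 'I_n) : injective g ->
  adj A *m A = 1%:M -> adj (colsub g A) *m colsub g A = 1%:M.
Proof.
move=> g_inj A1; apply/matrixP => i j.
have /matrixP/(_ (g i) (g j)) := A1; rewrite !mxE (inj_eq g_inj) => <-.
by apply: eq_bigr => k _; rewrite !mxE.
Qed.

(** Selecting columns of an isometry leaves an isometry; selecting rows afterwards only drops
    squared coordinates. *)
Lemma contraction_mxsub m n r c (A : 'M[C]_(m, n)) (f : 'I_r -> 'I_m)
    (g : 'I_c -> 'I_n) : injective f -> injective g -> adj A *m A = 1%:M ->
  contraction (mxsub f g A).
Proof.
move=> f_inj g_inj A1 v; rewrite -(vsq_isometry _ _ _ v (colsub_isometry _ _ _ A g g_inj A1)).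
have -> : mxsub f g A *m v = rowsub f (colsub g A *m v).
  apply/matrixP => i j; rewrite !mxE; apply: eq_bigr => k _; by rewrite !mxE.
rewrite /vsq; under eq_bigr do rewrite mxE.
by apply: (le_sum_inj _ _ f) => // j; apply: nsq_ge0.
Qed.

(** Prepends the index [i0] to the selection [f], enlarging a submatrix by one row or column. *)
Definition ext_ord {r n} (f : 'I_r -> 'I_n) (i0 : 'I_n) (i : 'I_r.+1) : 'I_n :=
  if unlift ord0 i is Some j then f j else i0.

Lemma ext_ord_inj r n (f : 'I_r -> 'I_n) i0 : injective f -> i0 \notin codom f ->
  injective (ext_ord f i0).
Proof.
move=> f_inj i0f i j; rewrite /ext_ord.
case: unliftP => [i' ->|->]; case: unliftP => [j' ->|->] //.
- by move=> /f_inj ->.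
- by move=> e; rewrite -e codom_f in i0f.
- by move=> e; rewrite e codom_f in i0f.
Qed.

Lemma codom_missing r n (f : 'I_r -> 'I_n) : (r < n)%N -> exists i0, i0 \notin codom f.
Proof.
move=> rn; apply/existsP; rewrite -[[exists _, _]]negbK negb_exists; apply/negP => /forallP all_f.
have : (#|'I_n| <= #|codom f|)%N.
  by apply/subset_leq_card/fintype.subsetP => i _; have := all_f i; rewrite negbK.
rewrite card_ord => /leq_trans/(_ (leq_image_card f _)); rewrite card_ord.
by rewrite leqNgt rn.
Qed.

Lemma opnorm_ext_row m n r c (A : 'M[C]_(m, n)) (f : 'I_r -> 'I_m) (g : 'I_c -> 'I_n) i0 :
  contraction (mxsub (ext_ord f i0) g A) ->
  opnorm (mxsub f g A) <= opnorm (mxsub (ext_ord f i0) g A).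
Proof.
move=> cM; apply: opnorm_le => v v1; apply: le_trans (opnorm_ge _ _ _ v cM v1).
rewrite -(ler_pXn2r (n := 2)) ?nnegrE ?vnorm_ge0 // !vnorm_sqr.
rewrite [leRHS]/vsq big_ord_recl -[leLHS]add0r lerD ?nsq_ge0 //.
rewrite le_eqVlt; apply/orP; left; apply/eqP; apply: eq_bigr => i _.
by rewrite !mxE; congr nsq; apply: eq_bigr => k _; rewrite !mxE /ext_ord liftK.
Qed.

Lemma opnorm_ext_col m n r c (A : 'M[C]_(m, n)) (f : 'I_r -> 'I_m) (g : 'I_c -> 'I_n) j0 :
  contraction (mxsub f (ext_ord g j0) A) ->
  opnorm (mxsub f g A) <= opnorm (mxsub f (ext_ord g j0) A).
Proof.
move=> cM; apply: opnorm_le => v v1.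
pose v' : 'cV[C]_(c.+1) := \col_i (if unlift ord0 i is Some j then v j 0 else 0).
have -> : mxsub f g A *m v = mxsub f (ext_ord g j0) A *m v'.
  apply/matrixP => i j; rewrite !ord1 !mxE big_ord_recl !mxE unlift_none mulr0 add0r.
  by apply: eq_bigr => k _; rewrite !mxE /ext_ord liftK.
apply: opnorm_ge => //; apply: le_trans v1.
rewrite -(ler_pXn2r (n := 2)) ?nnegrE ?vnorm_ge0 // !vnorm_sqr.
rewrite [leLHS]/vsq big_ord_recl !mxE unlift_none nsq0 add0r.
by rewrite le_eqVlt; apply/orP; left; apply/eqP; apply: eq_bigr => i _; rewrite !mxE liftK.
Qed.

Section SCoef.
Context {N : nat} (U : 'M[C]_N).
Hypothesis U_isom : adj U *m U = 1%:M.

Lemma opnorm_mxsub_le1 r c (f : 'I_r -> 'I_N) (g : 'I_c -> 'I_N) :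
  injective f -> injective g -> opnorm (mxsub f g U) <= 1.
Proof.
move=> f_inj g_inj; apply: opnorm_le => v v1.
have cM := contraction_mxsub _ _ _ _ U f g f_inj g_inj U_isom v.
rewrite -(expr_le1 (n := 2)) ?vnorm_ge0 // vnorm_sqr (le_trans cM) //.
by rewrite -vnorm_sqr expr_le1 // vnorm_ge0.
Qed.

Lemma s_coef_ge k r c (f : 'I_r -> 'I_N) (g : 'I_c -> 'I_N) :
  injective f -> injective g -> (r + c = k.+1)%N -> opnorm (mxsub f g U) <= s_coef U k.
Proof.
move=> f_inj g_inj rc; apply: ub_le_sup; last by exists r, c, f, g.
exists 1 => _ [r' [c' [f' [g' [fi gi _ ->]]]]]; exact: opnorm_mxsub_le1.
Qed.

(** For large [k] no submatrix has the required size and the supremum takes its default value 0,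
    hence the condition [0 <= x]. *)
Lemma s_coef_le k (x : R) : 0 <= x ->
  (forall r c (f : 'I_r -> 'I_N) (g : 'I_c -> 'I_N), injective f -> injective g ->
     (r + c = k.+1)%N -> opnorm (mxsub f g U) <= x) -> s_coef U k <= x.
Proof.
move=> x0 le_x; rewrite /s_coef; set E := (X in sup X).
have [E0|/set0P E0] := eqVneq E classical_sets.set0; first by rewrite E0 sup0.
by apply: ge_sup => // _ [r [c [f [g [fi gi rc ->]]]]]; apply: le_x.
Qed.

Lemma s_coef_ge0 k : 0 <= s_coef U k.
Proof.
rewrite /s_coef; set E := (X in sup X).
have [->|/set0P[x Ex]] := eqVneq E classical_sets.set0; first by rewrite sup0.
have [r [c [f [g [fi gi rc xE]]]]] := Ex; apply: le_trans (s_coef_ge _ _ _ f g fi gi rc).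
exact/opnorm_ge0/contraction_mxsub.
Qed.

Lemma s_coef_le1 k : s_coef U k <= 1.
Proof. by apply: s_coef_le => // r c f g fi gi _; apply: opnorm_mxsub_le1. Qed.

(** The bound on [k] leaves room for one more row or column, and enlarging a submatrix does not
    decrease its norm. *)
Lemma s_coef_mono k : (k.+1 < N + N)%N -> s_coef U k <= s_coef U k.+1.
Proof.
move=> kN; apply: s_coef_le => [|r c f g fi gi rc]; first exact: s_coef_ge0.
have [rN|Nr] := ltnP r N.
  have [i0 i0f] := codom_missing _ _ f rN.
  have f'i := ext_ord_inj _ _ f i0 fi i0f.
  apply: le_trans (opnorm_ext_row _ _ _ _ U f g i0 _) _.
    exact: contraction_mxsub.
  by apply: s_coef_ge => //; rewrite addSn rc.
have cN : (c < N)%N by lia.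
have [j0 j0g] := codom_missing _ _ g cN.
have g'i := ext_ord_inj _ _ g j0 gi j0g.
apply: le_trans (opnorm_ext_col _ _ _ _ U f g j0 _) _.
  exact: contraction_mxsub.
by apply: s_coef_ge => //; rewrite addnS rc.
Qed.

(** With all N rows and at least one column the submatrix is an isometry, so a basis vector attains
    norm 1. *)
Lemma s_coef1 k : (N <= k < N + N)%N -> s_coef U k = 1.
Proof.
move=> /andP[Nk kN]; apply/le_anti; rewrite s_coef_le1 /=.
have cN : (k.+1 - N <= N)%N by lia.
have gi : injective (widen_ord cN) by move=> i j /(congr1 val) /= ij; apply: val_inj.
have fi : injective (@id 'I_N) by [].
apply: le_trans (s_coef_ge k N (k.+1 - N) id (widen_ord cN) fi gi _); last by lia.
have c0 : (0 < k.+1 - N)%N by lia.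
pose v : 'cV[C]_(k.+1 - N) := delta_mx (Ordinal c0) 0.
have v1 : vsq v = 1.
  rewrite /vsq (bigD1 (Ordinal c0)) //= big1 => [|i /negbTE ni].
    by rewrite !mxE !eqxx /nsq /= expr1n expr0n /= !addr0.
  by rewrite !mxE ni nsq0.
have Mv1 : vsq (mxsub id (widen_ord cN) U *m v) = 1.
  by rewrite -[mxsub _ _ _]/(colsub _ _) vsq_isometry // colsub_isometry.
have nMv1 : vnorm (mxsub id (widen_ord cN) U *m v) = 1.
  by rewrite /vnorm -[X in Num.sqrt X]/(vsq _) Mv1 sqrtr1.
rewrite -[leLHS]nMv1; apply: opnorm_ge; first exact: contraction_mxsub.
by rewrite /vnorm -[X in Num.sqrt X]/(vsq _) v1 sqrtr1.
Qed.

End SCoef.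
End Norms.

(** * S_k as a combination of Ky Fan bounds *)

Section SAbel.
Context {R : realType}.

                                                                                   
                                    
(** Upper bound for the sum of the [m] largest eigenvalues of 1 plus the compression of [coupling]
    to [k] coordinates. Beyond [m = k] it is the trace [k]. *)
Definition ky_fan_bound (s : nat -> R) (k m : nat) : R :=
  if (m <= k)%N then m%:R + \sum_(i < minn m (k - m)) s (k - i.+1)%N else k%:R.

Lemma ky_fan_bound0 s k : ky_fan_bound s k 0 = 0.
Proof. by rewrite /ky_fan_bound min0n big_ord0 addr0. Qed.

(** The step from [m] gives the coefficient of lambda_{m+1} in S_k. While min(m, k-m) grows a term
    s_{k-m-1} enters, in the middle of an odd [k] it stays put, and afterwards the term s_m
    leaves. *)
Lemma ky_fan_bound_step s k m : ky_fan_bound s k m.+1 - ky_fan_bound s k m =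
  if (m < k./2)%N then 1 + s (k - m.+1)%N
  else if (m < uphalf k)%N then 1 else if (m < k)%N then 1 - s m else 0.
Proof.
have k2 : k = (k./2 + uphalf k)%N by rewrite uphalf_half addnCA addnn odd_double_half.
have uh : uphalf k = (odd k + k./2)%N by rewrite uphalf_half.
have o1 : (odd k <= 1)%N by case: odd.
rewrite /ky_fan_bound.
case: (ltnP m k./2) => m1.
  have -> : (m < k)%N by lia.
  have -> : (m <= k)%N by lia.
  have -> : minn m.+1 (k - m.+1) = m.+1 by lia.
  have -> : minn m (k - m) = m by lia.
  by rewrite big_ord_recr /= -natr1; ring.
case: (ltnP m (uphalf k)) => m2.
  have -> : (m < k)%N by lia.
  have -> : (m <= k)%N by lia.
  have -> : minn m.+1 (k - m.+1) = m by lia.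
  have -> : minn m (k - m) = m by lia.
  by rewrite -natr1; ring.
case: (ltnP m k) => m3; last first.
  have [->|/negbTE mk] := eqVneq m k; last first.
    by have -> : (m <= k)%N = false; [lia|rewrite subrr].
  by rewrite leqnn subnn minn0 big_ord0 addr0 subrr.
rewrite ltnW //.
have -> : minn m.+1 (k - m.+1) = (k - m.+1)%N by lia.
have -> : minn m (k - m) = (k - m.+1).+1 by lia.
rewrite big_ord_recr /= subnSK // subKn; last exact: ltnW.
by rewrite -natr1; ring.
Qed.

Section Spec.
Context {N : nat} (U : 'M[R[i]]_N) (lam : 'I_N -> R).
Local Notation s := (s_coef U).
Local Notation l := (fun j => lamx lam j.+1).

Lemma lamx_ord (i : 'I_N) : lamx lam i.+1 = lam i.
Proof. by rewrite /lamx /= valK. Qed.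

Lemma lamx_ge j : (N <= j)%N -> lamx lam j.+1 = 0.
Proof. by move=> Nj; rewrite /lamx insubN //= -leqNgt. Qed.

Lemma S_coefE k : S_coef U lam k =
  \sum_(j < k) l j * (ky_fan_bound s k j.+1 - ky_fan_bound s k j).
Proof.
under eq_bigr do rewrite ky_fan_bound_step.
rewrite /S_coef; cbv zeta; case: eqP => [->|/eqP k0]; first by rewrite big_ord0.
rewrite -(big_mkord xpredT (fun j => lamx lam j.+1 *
  if (j < k./2)%N then 1 + s (k - j.+1)%N
  else if (j < uphalf k)%N then 1 else if (j < k)%N then 1 - s j else 0)).
have k2 : (k./2 <= k)%N by lia.
rewrite [RHS](@big_cat_nat _ _ _ k./2) //= !big_add1 /=.
have -> : \sum_(0 <= j < k./2) lamx lam j.+1 *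
  (if (j < k./2)%N then 1 + s (k - j.+1)%N
  else if (j < uphalf k)%N then 1 else if (j < k)%N then 1 - s j else 0)
  = \sum_(0 <= j < k./2) lamx lam j.+1 * (1 + s (k - j.+1)%N).
  by apply: eq_big_nat => j /andP[_ ->].
have tail a : (uphalf k <= a)%N -> \sum_(a <= j < k) lamx lam j.+1 * (1 - s j) =
  \sum_(a <= j < k) lamx lam j.+1 *
  (if (j < k./2)%N then 1 + s (k - j.+1)%N
  else if (j < uphalf k)%N then 1 else if (j < k)%N then 1 - s j else 0).
  move=> ha; apply: eq_big_nat => j /andP[aj jk].
  have -> : (j < k./2)%N = false by lia.
  by have -> : (j < uphalf k)%N = false; [lia | rewrite jk].
have uh : uphalf k = (odd k + k./2)%N by rewrite uphalf_half.
case: ifP => ok; first by rewrite tail // uh (negbTE ok).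
have ok1 : odd k by rewrite -[odd k]negbK ok.
rewrite ok1 add1n in uh.
rewrite [in X in _ = _ + X]big_ltn; last by lia.
rewrite ltnn uh leqnn mulr1 addrA; congr (_ + _).
by rewrite -[in RHS]uh -tail ?uh // big_add1.
Qed.

(** Summation by parts; the range can be N instead of [k] because the increments vanish from [k] on
    and the extended eigenvalues from N on. *)
Lemma S_coef_abel k : S_coef U lam k =
  \sum_(j < N) (l j - l j.+1) * ky_fan_bound s k j.+1.
Proof.
pose d j := ky_fan_bound s k j.+1 - ky_fan_bound s k j.
have sum_d m : \sum_(j < m) d j = ky_fan_bound s k m.
  by rewrite -(big_mkord xpredT d) telescope_sumr // ky_fan_bound0 subr0.
have d0 j : (k <= j)%N -> d j = 0.
  move=> kj; rewrite /d ky_fan_bound_step.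
  have -> : (j < k./2)%N = false by lia.
  have -> : (j < uphalf k)%N = false by lia.
  by rewrite ltnNge kj.
have -> : S_coef U lam k = \sum_(j < N) l j * d j.
  rewrite S_coefE -!(big_mkord xpredT (fun j => l j * d j)).
  have [kN|/ltnW Nk] := leqP k N.
    rewrite [RHS](@big_cat_nat _ _ _ k) //= -[LHS]addr0; congr (_ + _).
    by rewrite big_nat_cond big1 // => j /andP[/andP[kj _] _]; rewrite d0 ?mulr0.
  rewrite [LHS](@big_cat_nat _ _ _ N) //= -[RHS]addr0; congr (_ + _).
  by rewrite big_nat_cond big1 // => j /andP[/andP[kj _] _]; rewrite lamx_ge ?mul0r.
rewrite (abel_sum _ (fun j => lamx lam j.+1)) lamx_ge // mul0r addr0.
by apply: eq_bigr => j _; rewrite sum_d.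
Qed.

Hypothesis U_isom : adj U *m U = 1%:M.
Hypothesis lam_ge0 : forall i, 0 <= lam i.
Hypothesis lam_sorted : forall i j : 'I_N, (i <= j)%N -> lam j <= lam i.

Lemma lamx_decr j : 0 <= l j - l j.+1.
Proof.
rewrite subr_ge0; have [jN|Nj] := ltnP j.+1 N; last first.
  rewrite lamx_ge //; have [jN|/lamx_ge -> //] := ltnP j N.
  by rewrite (lamx_ord (Ordinal jN)).
by rewrite (lamx_ord (Ordinal jN)) (lamx_ord (Ordinal (ltnW jN))) lam_sorted /=.
Qed.

Lemma ky_fan_bound_mono k m : (k < N + N)%N ->
  ky_fan_bound s k m <= ky_fan_bound s k.+1 m.
Proof.
move=> kN; rewrite /ky_fan_bound; have [mk|km] := leqP m k; last first.
  case: ifP => mk1; last by rewrite ler_nat.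
  have -> : m = k.+1 by lia.
  by rewrite -[leLHS]addr0 lerD ?ler_nat // sumr_ge0 // => i _; apply: s_coef_ge0.
rewrite leqW // lerD2l.
have mm : (minn m (k - m) <= minn m (k.+1 - m))%N by lia.
rewrite -!(big_mkord xpredT (fun i => s (_ - i.+1)%N)).
rewrite [leRHS](@big_cat_nat _ _ _ (minn m (k - m))) //= -[leLHS]addr0 lerD //; last first.
  by apply: sumr_ge0 => i _; apply: s_coef_ge0.
rewrite !big_nat; apply: ler_sum => i /andP[_ im].
have -> : (k.+1 - i.+1 = (k - i.+1).+1)%N by lia.
by apply: s_coef_mono => //; lia.
Qed.

Lemma S_coef_mono k : (k < N + N)%N -> S_coef U lam k <= S_coef U lam k.+1.
Proof.
move=> kN; rewrite !S_coef_abel; apply: ler_sum => j _.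
by rewrite ler_wpM2l ?lamx_decr // ky_fan_bound_mono.
Qed.

(** At k = 2N only s_j with N <= j < 2N occur; they all equal 1, so each bound is [2 * m]. *)
Lemma S_coef_total : S_coef U lam (N + N) = 2 * \sum_i lam i.
Proof.
have bE m : (m <= N)%N -> ky_fan_bound s (N + N) m = m%:R * 2.
  move=> mN; rewrite /ky_fan_bound.
  have -> : (m <= N + N)%N by lia.
  have -> : minn m (N + N - m) = m by lia.
  rewrite (eq_bigr (fun=> 1)) => [|i _]; first by rewrite sumr_const card_ord; ring.
  by apply: s_coef1 => //; have := ltn_ord i; lia.
rewrite S_coef_abel.
have -> : \sum_i lam i = \sum_(j < N) l j * 1.
  by apply: eq_bigr => i _; rewrite lamx_ord mulr1.
rewrite (abel_sum _ (fun j => lamx lam j.+1) (fun=> 1)) lamx_ge // mul0r addr0.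
rewrite mulr_sumr; apply: eq_bigr => j _.
by rewrite bE // sumr_const card_ord; ring.
Qed.

End Spec.
End SAbel.

(** * The quadratic form of the coupling matrix *)

Lemma sum_supported (V : nmodType) (T : finType) (A : {set T}) (F : T -> V) :
  (forall i, i \notin A -> F i = 0) -> \sum_i F i = \sum_(i < #|A|) F (enum_val i).
Proof.
move=> F0; rewrite (bigID (mem A)) /= [X in _ + X]big1 ?addr0 //.
by rewrite big_enum_val.
Qed.

Section QuadraticForm.
Context {R : realType}.
Local Notation C := R[i].

(** LQ factorization by Gram-Schmidt on the rows of [B] padded with zero rows: row i of [B] lies in
    the span of the first rows of [Z] up to i, so it is orthogonal to every later row. *)
Lemma lq_factor m k (B : 'M[C]_(m, k)) : (m <= k)%N ->
  exists2 Z : 'M[C]_k, Z *m adj Z = 1%:M &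
    forall (i : 'I_m) (j : 'I_k), (i < j)%N -> (B *m adj Z) i j = 0.
Proof.
move=> mk; pose V := \matrix_(i < k) oapp (fun l => row l B) 0 (insub (val i)).
have adjE p q (A : 'M[C]_(p, q)) : adj A = map_mx Num.conj A^T by rewrite /adj map_trmx.
have Z1 : schmidt V *m adj (schmidt V) = 1%:M.
  by rewrite adjE; apply/unitarymxP/schmidt_unitarymx.
exists (schmidt V) => // i j ij; set Z := schmidt V in Z1 *.
pose i' : 'I_k := widen_ord mk i.
have rowV : row i' V = row i B.
  by rewrite rowK /= insubT //= => ?; congr row; apply: val_inj.
have : (row i' V <= kermx (adj (row j Z)))%MS.
  apply: submx_trans (row_schmidt_sub _ _) _; apply/sumsmx_subP => l li.
  rewrite genmxE; apply/sub_kermxP/matrixP => a b; rewrite !ord1.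
  have /matrixP/(_ l j) := Z1; rewrite [RHS]mxE.
  have -> : (l == j) = false by apply/negbTE; rewrite -val_eqE /=; move: li => /=; lia.
  by rewrite mulr0n => e; rewrite [RHS]mxE; apply: etrans e; rewrite !mxE; apply: eq_bigr => x _; rewrite !mxE.
rewrite rowV => /sub_kermxP/matrixP/(_ 0 0) e; rewrite [RHS]mxE in e.
by apply: etrans e; rewrite !mxE; apply: eq_bigr => x _; rewrite !mxE.
Qed.

Lemma rowsub_coisometry m n p (Y : 'M[C]_(m, n)) (f : 'I_p -> 'I_m) :
  injective f -> Y *m adj Y = 1%:M -> rowsub f Y *m adj (rowsub f Y) = 1%:M.
Proof.
move=> f_inj Y1; apply/matrixP => i j.
have /matrixP/(_ (f i) (f j)) := Y1; rewrite !mxE (inj_eq f_inj) => <-.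
by apply: eq_bigr => x _; rewrite !mxE.
Qed.

                                                                                      
(** Termwise 2 t Re(a w) <= t^2 |a|^2 + |w|^2, summed and divided by t; for t = 0 the hypothesis
    forces w = 0. *)
Lemma re_dot_le n (a w : 'I_n -> C) (t b : R) : 0 <= t -> 0 <= b ->
  \sum_i nsq (w i) <= t ^+ 2 * b ->
  2 * complex.Re (\sum_i a i * w i) <= t * (\sum_i nsq (a i) + b).
Proof.
move=> t0 b0 wt; have [t_eq0|t_neq0] := eqVneq t 0.
  rewrite t_eq0 expr0n /= mul0r in wt; rewrite t_eq0 mul0r.
  have w0 i : w i = 0.
    have /eqP : \sum_i nsq (w i) = 0.
      by apply/le_anti; rewrite wt sumr_ge0 // => j _; apply: nsq_ge0.
    rewrite psumr_eq0 => [|j _]; last exact: nsq_ge0.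
    move/allP => /(_ i); rewrite mem_index_enum => /(_ isT) /=.
    rewrite /nsq paddr_eq0 ?sqr_ge0 // !sqrf_eq0.
    by case: (w i) => x y /= /andP[/eqP -> /eqP ->].
  by rewrite big1 /= ?mulr0 // => i _; rewrite w0 mulr0.
have t_gt0 : 0 < t by rewrite lt_neqAle eq_sym t_neq0.
rewrite -(ler_pM2l t_gt0) Re_sum.
have amgm i : 2 * t * complex.Re (a i * w i) <= t ^+ 2 * nsq (a i) + nsq (w i).
  case: (a i) (w i) => [x y] [u v]; rewrite /nsq /= -subr_ge0.
  have -> : t ^+ 2 * (x ^+ 2 + y ^+ 2) + (u ^+ 2 + v ^+ 2) - 2 * t * (x * u - y * v) =
    (t * x - u) ^+ 2 + (t * y + v) ^+ 2 by ring.
  by rewrite addr_ge0 ?sqr_ge0.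
have : \sum_i 2 * t * complex.Re (a i * w i) <=
    \sum_i (t ^+ 2 * nsq (a i) + nsq (w i)) by apply: ler_sum => i _.
by rewrite big_split /= -!mulr_sumr; lra.
Qed.

Section Coupling.
Context {N : nat} (U : 'M[C]_N).
Local Notation s := (s_coef U).

Definition coupling : 'M[C]_(N + N) := block_mx 0 U (adj U) 0.

Definition qform (y : 'rV[C]_(N + N)) : R :=
  complex.Re ((y *m coupling *m adj y) 0 0).

Definition supported {m n} (S : {set 'I_n}) (Y : 'M[C]_(m, n)) :=
  forall i x, x \notin S -> Y i x = 0.

Lemma qform_row m (Y : 'M[C]_(m, N + N)) i :
  qform (row i Y) = complex.Re ((Y *m coupling *m adj Y) i i).
Proof.
rewrite /qform -row_mul; congr complex.Re; rewrite !mxE.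
by apply: eq_bigr => x _; rewrite !mxE.
Qed.

Lemma qform_sum m (Y : 'M[C]_(m, N + N)) :
  \sum_i qform (row i Y) = complex.Re (\tr (Y *m coupling *m adj Y)).
Proof. by rewrite /mxtrace Re_sum; apply: eq_bigr => i _; rewrite qform_row. Qed.

Lemma qform_row_mx (a b : 'rV[C]_N) :
  qform (row_mx a b) = 2 * complex.Re ((a *m U *m adj b) 0 0).
Proof.
rewrite /qform mul_row_block !mulmx0 add0r addr0.
have -> : adj (row_mx a b) = col_mx (adj a) (adj b).
  by rewrite /adj map_row_mx tr_row_mx.
rewrite mul_row_col mxE ReD mulr_natl mulr2n; congr (_ + _).
have -> : b *m adj U *m adj a = adj (a *m U *m adj b).
  by rewrite !adjM adjK mulmxA.
by rewrite mxE mxE; case: (_ 0 0).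
Qed.

Lemma card_lrshift (S : {set 'I_(N + N)}) :
  (#|[set i | lshift N i \in S]| + #|[set j | rshift N j \in S]|)%N = #|S|.
Proof.
by rewrite -!sum1dep_card -[RHS]sum1_card big_split_ord.
Qed.

Hypothesis U_isom : adj U *m U = 1%:M.

(** Splitting [y] into halves a, b turns the form into 2 Re(a U b†), which sees only the submatrix
    of U with rows [I] and columns [J]. Its rows and columns number #|S| together, hence the index
    #|S| - 1. *)
Lemma qform_le (S : {set 'I_(N + N)}) (y : 'rV[C]_(N + N)) :
  supported S y -> (0 < #|S|)%N ->
  qform y <= s #|S|.-1 * \sum_x nsq (y 0 x).
Proof.
move=> yS S_gt0; rewrite -[y]hsubmxK qform_row_mx.
set a := lsubmx y; set b := rsubmx y.
pose I := [set i | lshift N i \in S]; pose J := [set j | rshift N j \in S].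
have aI i : i \notin I -> a 0 i = 0 by rewrite inE mxE => /yS.
have bJ j : j \notin J -> b 0 j = 0 by rewrite inE mxE => /yS.
pose f : 'I_#|I| -> 'I_N := enum_val; pose g : 'I_#|J| -> 'I_N := enum_val.
have fi : injective f by exact: enum_val_inj.
have gi : injective g by exact: enum_val_inj.
pose M := mxsub f g U; pose v : 'cV[C]_#|J| := \col_j Num.conj (b 0 (g j)).
have cM : contraction M by exact: contraction_mxsub.
have -> : (a *m U *m adj b) 0 0 = \sum_i a 0 (f i) * (M *m v) i 0.
  rewrite -mulmxA mxE (sum_supported _ _ I) => [|i /aI ->]; last by rewrite mul0r.
  apply: eq_bigr => i _; rewrite !mxE (sum_supported _ _ J) => [|j /bJ].
    by congr (_ * _); apply: eq_bigr => j _; rewrite !mxE.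
  by rewrite !mxE => ->; rewrite rmorph0 mulr0.
have wv := opnorm_bound _ _ M v cM.
have := re_dot_le _ (fun i => a 0 (f i)) _ _ _ (opnorm_ge0 _ _ M cM) (vsq_ge0 _ v) wv.
move/le_trans; apply; rewrite big_split_ord /=.
have -> : \sum_i nsq (a 0 (f i)) = \sum_i nsq (row_mx a b 0 (lshift N i)).
  rewrite -(sum_supported _ _ I (fun i => nsq (a 0 i))) => [|i /aI ->]; last exact: nsq0.
  by apply: eq_bigr => i _; rewrite row_mxEl.
have -> : vsq v = \sum_i nsq (row_mx a b 0 (rshift N i)).
  transitivity (\sum_i nsq (b 0 i)); last by apply: eq_bigr => i _; rewrite row_mxEr.
  rewrite (sum_supported _ _ J) => [|i /bJ ->]; last exact: nsq0.
  by apply: eq_bigr => i _; rewrite !mxE nsq_conj.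
apply: ler_wpM2r; first by rewrite addr_ge0 // sumr_ge0 // => i _; apply: nsq_ge0.
by apply: s_coef_ge => //; rewrite card_lrshift prednK.
Qed.

Lemma coisometry_row_sq m n (Y : 'M[C]_(m, n)) i : Y *m adj Y = 1%:M ->
  \sum_x nsq (Y i x) = 1.
Proof.
move=> /matrixP/(_ i i); rewrite !mxE eqxx => /(congr1 (@complex.Re R)).
rewrite Re_sum /= => <-; apply: eq_bigr => x _; by rewrite nsqE !mxE.
Qed.

(** Induction on the number of orthonormal rows, in place of eigenvalue interlacing: after a
    rotation one row carries all of a chosen coordinate x of [S], and the others are supported on
    [S] without x. *)
Lemma qform_sum_le m (S : {set 'I_(N + N)}) (Y : 'M[C]_(m, N + N)) :
  Y *m adj Y = 1%:M -> supported S Y ->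
  \sum_i qform (row i Y) <= \sum_(i < m) s (#|S| - i.+1)%N.
Proof.
elim: m S Y => [|m IH] S Y Y1 YS; first by rewrite !big_ord0.
have [S0|[x xS]] := set_0Vmem S.
  have /eqP := coisometry_row_sq _ _ Y 0 Y1; rewrite big1 ?(eq_sym 0) ?oner_eq0 // => x _.
  by rewrite YS ?S0 ?inE // nsq0.
(* Factoring a single row yields a unitary [Z] for which column x of [Z *m Y] vanishes below its
   first entry. *)
have [Z Z1 Zx] := lq_factor 1 m.+1 (adj (col x Y)) isT.
pose Y' := Z *m Y.
have Y'1 : Y' *m adj Y' = 1%:M by rewrite adjM mulmxA -(mulmxA Z) Y1 mulmx1.
(* The sum is a trace, hence unchanged by the rotation. *)
have -> : \sum_i qform (row i Y) = \sum_i qform (row i Y').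
  rewrite !qform_sum; congr complex.Re.
  rewrite adjM !mulmxA [RHS]mxtrace_mulC !mulmxA (mulmx1C Z1) mul1mx.
  by [].
have Y'S : supported S Y'.
  by move=> i z zS; rewrite mxE big1 // => j _; rewrite YS ?mulr0.
have Y'x (i : 'I_m) : Y' (lift ord0 i) x = 0.
  have := Zx 0 (lift ord0 i) isT; rewrite -adjM mxE mxE => /eqP.
  rewrite conjC_eq0 => /eqP e; apply: etrans e; rewrite !mxE.
  by apply: eq_bigr => j _; rewrite !mxE.
rewrite !big_ord_recl; apply: lerD.
  have S_gt0 : (0 < #|S|)%N by apply/card_gt0P; exists x.
  have y0S : supported S (row ord0 Y') by move=> i z zS; rewrite mxE Y'S.
  have := qform_le _ _ y0S S_gt0.
  under eq_bigr do rewrite mxE.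
  by rewrite coisometry_row_sq // mulr1 subn1.
have Y'T : supported (S :\ x) (rowsub (lift ord0) Y').
  by move=> i z; rewrite !inE negb_and negbK mxE => /orP[/eqP ->|/Y'S].
have := IH _ _ (rowsub_coisometry _ _ _ Y' (lift ord0) lift_inj Y'1) Y'T.
have -> : #|S| = #|S :\ x|.+1 by rewrite (cardsD1 x) xS.
move=> le1; apply: le_trans le1.
by rewrite le_eqVlt; apply/orP; left; apply/eqP; apply: eq_bigr => i _; rewrite row_rowsub.
Qed.

End Coupling.
End QuadraticForm.

(** * Ky Fan bound for the columns of the frame *)

Section KyFan.
Context {R : realType}.
Local Notation C := R[i].

Lemma Re_diag_gram m n (A : 'M[C]_(m, n)) x :
  complex.Re ((adj A *m A) x x) = \sum_i nsq (A i x).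
Proof. by rewrite mxE Re_sum; apply: eq_bigr => i _; rewrite !mxE nsqE mulrC. Qed.

Lemma Re_diag_cogram m n (A : 'M[C]_(m, n)) i :
  complex.Re ((A *m adj A) i i) = \sum_x nsq (A i x).
Proof. by rewrite mxE Re_sum; apply: eq_bigr => x _; rewrite !mxE nsqE. Qed.

Lemma nsq_row_mul m k (B : 'M[C]_(m, k)) (Z : 'M[C]_k) i : Z *m adj Z = 1%:M ->
  \sum_x nsq (B i x) = \sum_x nsq ((B *m adj Z) i x).
Proof.
move=> Z1.
by rewrite -!Re_diag_cogram adjM adjK mulmxA -(mulmxA B) (mulmx1C Z1) mulmx1.
Qed.

Context {N : nat} (U : 'M[C]_N).
Hypothesis U_isom : adj U *m U = 1%:M.
Local Notation s := (s_coef U).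

Definition frame : 'M[C]_(N, N + N) := row_mx 1%:M U.

Lemma frame_gram : adj frame *m frame = 1%:M + coupling U.
Proof.
have -> : adj frame = col_mx 1%:M (adj U).
  by rewrite /adj map_row_mx tr_row_mx map_mx1 trmx1.
rewrite mul_col_row !mul1mx mulmx1 U_isom.
by rewrite /coupling -[1%:M in RHS]submxK scalar_mx_block block_mxKul block_mxKur
  block_mxKdl block_mxKdr add_block_mx !addr0 !add0r.
Qed.

Lemma coupling_diag x : coupling U x x = 0.
Proof.
by rewrite /coupling; case: (split_ordP x) => i ->; rewrite ?block_mxEul ?block_mxEdr mxE.
Qed.

Lemma qform_flip (y : 'rV[C]_(N + N)) :
  qform U (row_mx (lsubmx y) (- rsubmx y)) = - qform U y.
Proof.
rewrite -{3}[y]hsubmxK !qform_row_mx.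
have -> : adj (- rsubmx y) = - adj (rsubmx y).
  by apply/matrixP => i j; rewrite !mxE rmorphN.
by rewrite mulmxN mxE ReN mulrN.
Qed.

(** Negating the second half preserves orthonormality and support and changes the sign of the form:
    the spectrum of the compression is symmetric about 0. *)
Definition flip {m} (Y : 'M[C]_(m, N + N)) := row_mx (lsubmx Y) (- rsubmx Y).

Lemma flip_gram m (Y : 'M[C]_(m, N + N)) : flip Y *m adj (flip Y) = Y *m adj Y.
Proof.
have adjr (a b : 'M[C]_(m, N)) : adj (row_mx a b) = col_mx (adj a) (adj b).
  by rewrite /adj map_row_mx tr_row_mx.
rewrite -{3 4}[Y]hsubmxK /flip !adjr !mul_row_col; congr (_ + _).
have -> : adj (- rsubmx Y) = - adj (rsubmx Y).
  by apply/matrixP => i j; rewrite !mxE rmorphN.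
by rewrite mulmxN mulNmx opprK.
Qed.

Lemma flip_row m (Y : 'M[C]_(m, N + N)) i :
  qform U (row i (flip Y)) = - qform U (row i Y).
Proof.
rewrite -qform_flip; congr qform.
by rewrite /flip row_row_mx; congr row_mx; apply/matrixP => a b; rewrite !mxE.
Qed.

Lemma flip_supported m S (Y : 'M[C]_(m, N + N)) :
  supported S Y -> supported S (flip Y).
Proof.
move=> YS i x xS; rewrite /flip; move: xS; case: (split_ordP x) => j -> xS.
  by rewrite row_mxEl mxE YS.
by rewrite row_mxEr !mxE YS ?oppr0.
Qed.

                                                                             
                                  
(** For m <= k - m this is [qform_sum_le]. Otherwise the zero total turns the first m rows into
    minus the last k - m, and [flip] absorbs the sign. *)
Lemma qform_partial_le k m (S : {set 'I_(N + N)}) (Y : 'M[C]_(k, N + N)) :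
  (m <= k)%N -> k = #|S| -> Y *m adj Y = 1%:M -> supported S Y ->
  \sum_i qform U (row i Y) = 0 ->
  \sum_(i < k | (i < m)%N) qform U (row i Y) <=
  \sum_(i < minn m (k - m)) s (k - i.+1)%N.
Proof.
move=> mk kS Y1 YS sum0.
have top p (Y' : 'M[C]_(k, N + N)) (pk : (p <= k)%N) : Y' *m adj Y' = 1%:M ->
    supported S Y' -> \sum_(i < k | (i < p)%N) qform U (row i Y') <=
    \sum_(i < p) s (k - i.+1)%N.
  move=> Y'1 Y'S; rewrite (big_ord_narrow pk).
  have wi : injective (widen_ord pk) by move=> i j /(congr1 val) /= ij; apply: val_inj.
  have := qform_sum_le U U_isom p S (rowsub (widen_ord pk) Y').
  rewrite -kS => /(_ (rowsub_coisometry _ _ _ _ _ wi Y'1)) le1.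
  apply: le_trans (le1 _); last by move=> i x xS; rewrite mxE Y'S.
  by rewrite le_eqVlt; apply/orP; left; apply/eqP; apply: eq_bigr => i _; rewrite row_rowsub.
case: (leqP m (k - m)) => mkm; first exact: top.
have ri : injective (@rev_ord k) by exact: rev_ord_inj.
(* The reversal moves the last k - m rows to the front, where [top] applies. *)
pose Y' := rowsub (@rev_ord k) (flip Y).
have -> : \sum_(i < k | (i < m)%N) qform U (row i Y) =
    \sum_(i < k | (i < k - m)%N) qform U (row i Y').
  move: sum0; rewrite (bigID (fun i : 'I_k => (i < m)%N)) /= => /eqP.
  rewrite addr_eq0 => /eqP ->; rewrite -sumrN (reindex_inj ri) /=.
  apply: eq_big => [i|i _]; first by have := ltn_ord i; lia.
  by rewrite row_rowsub flip_row.
apply: top; first exact: leq_subr.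
  by apply: rowsub_coisometry => //; rewrite flip_gram.
by move=> i x xS; rewrite mxE; apply: (flip_supported _ S).
Qed.

                                                              
                                                                                
                                                   
(** For m > #|S| the bound is the number of columns, each of unit norm. Otherwise the m by #|S|
    block is rotated to lower triangular form, so its mass sits in m columns; completing these to
    all N rows gives diagonal entries of a rotated Gram matrix, each 1 plus a value of [qform]. *)
Lemma ky_fan_le (V : 'M[C]_N) (S : {set 'I_(N + N)}) m :
  V *m adj V = 1%:M -> (m <= N)%N ->
  \sum_(j < N | (j < m)%N) \sum_(x in S) nsq ((V *m frame) j x) <=
  ky_fan_bound s #|S| m.
Proof.
move=> V1 mN; have V1' := mulmx1C V1.
have isoV p (D : 'M[C]_(N, p)) x :
    \sum_j nsq ((V *m D) j x) = complex.Re ((adj D *m D) x x).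
  by rewrite -Re_diag_gram adjM mulmxA -(mulmxA _ (adj V)) V1' mulmx1.
rewrite /ky_fan_bound; have [mk|km] := leqP m #|S|; last first.
  rewrite exchange_big /= -sum1_card natr_sum; apply: ler_sum => x _.
  apply: le_trans (_ : \sum_j nsq ((V *m frame) j x) <= _).
    rewrite [leRHS](bigID (fun j : 'I_N => (j < m)%N)) /= lerDl.
    by apply: sumr_ge0 => j _; apply: nsq_ge0.
  by rewrite isoV frame_gram mxE coupling_diag !mxE eqxx /= addr0.
set k := #|S| in mk *; pose e : 'I_k -> 'I_(N + N) := enum_val.
pose E : 'M[C]_(k, N + N) := rowsub e 1%:M.
have e_inj : injective e by exact: enum_val_inj.
have E1 : E *m adj E = 1%:M.
  by apply: rowsub_coisometry => //; rewrite adj1 mulmx1.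
have selE p (D : 'M[C]_(p, N + N)) i l : (D *m adj E) i l = D i (e l).
  rewrite mxE (bigD1 (e l)) //= big1 ?addr0 => [|x /negbTE xl].
    by rewrite !mxE eqxx rmorph1 mulr1.
  by rewrite !mxE eq_sym xl rmorph0 mulr0.
pose B := rowsub (widen_ord mN) (V *m frame *m adj E).
have [Z Z1 Zlow] := lq_factor m k B mk.
pose Y := Z *m E.
have Y1 : Y *m adj Y = 1%:M by rewrite adjM mulmxA -(mulmxA Z) E1 mulmx1.
have YS : supported S Y.
  move=> i x xS; rewrite mxE big1 // => l _; rewrite !mxE.
  have -> : (e l == x) = false.
    by apply/negbTE; apply: contraNneq xS => <-; apply: enum_valP.
  by rewrite mulr0.
have BZ i l : (B *m adj Z) i l = (V *m (frame *m adj Y)) (widen_ord mN i) l.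
  rewrite adjM !mulmxA !mxE; apply: eq_bigr => a _; rewrite !mxE.
  by congr (_ * _).
have -> : \sum_(j < N | (j < m)%N) \sum_(x in S) nsq ((V *m frame) j x) =
    \sum_(i < m) \sum_(l < k) nsq ((B *m adj Z) i l).
  rewrite (big_ord_narrow mN); apply: eq_bigr => i _.
  rewrite -nsq_row_mul // big_enum_val; apply: eq_bigr => l _.
  by rewrite [B _ _]mxE selE.
apply: le_trans (_ : \sum_(l < k | (l < m)%N) \sum_j nsq ((V *m (frame *m adj Y)) j l) <= _).
  rewrite exchange_big /= (bigID (fun l : 'I_k => (l < m)%N)) /=.
  (* Columns from [m] on vanish by triangularity. *)
  rewrite [X in _ + X]big1 ?addr0 => [|l]; last first.
    rewrite -leqNgt => ml; rewrite big1 // => i _.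
    by rewrite Zlow ?nsq0 // (leq_trans _ ml).
  apply: ler_sum => l _; under eq_bigr do rewrite BZ.
  have wi : injective (widen_ord mN) by move=> i j /(congr1 val) /= ij; apply: val_inj.
  apply: (le_sum_inj _ _ (widen_ord mN) (fun j => nsq ((V *m (frame *m adj Y)) j l)) wi).
  by move=> j; apply: nsq_ge0.
have rowY l : \sum_j nsq ((V *m (frame *m adj Y)) j l) = 1 + qform U (row l Y).
  rewrite isoV adjM adjK mulmxA -(mulmxA Y) frame_gram mulmxDr mulmx1 mulmxDl Y1.
  by rewrite mxE ReD qform_row !mxE eqxx.
under eq_bigr do rewrite rowY.
rewrite big_split /= (big_ord_narrow mk) sumr_const card_ord lerD2l.
apply: qform_partial_le => //.
(* The total is the trace of the compression of [coupling], whose diagonal is zero. *)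
rewrite qform_sum /Y adjM -!mulmxA mxtrace_mulC -!mulmxA (mulmx1C Z1) mulmx1.
rewrite /mxtrace Re_sum big1 // => l _.
rewrite mulmxA selE mxE (bigD1 (e l)) //= big1 ?addr0 => [|x /negbTE xl].
  by rewrite coupling_diag mulr0.
by rewrite !mxE eq_sym xl mul0r.
Qed.

End KyFan.

(** * Diagonalization of the state, majorization and entropies *)

Section Assembly.
Context {R : realType}.
Local Notation C := R[i].

Lemma prod_XsubC_perm (F : fieldType) (r t : seq F) :
  \prod_(a <- r) ('X - a%:P) = \prod_(a <- t) ('X - a%:P) -> perm_eq r t.
Proof. by move=> e; apply/allP => x _ /=; rewrite -!mu_prod_XsubC e. Qed.

(** The spectral theorem yields eigenvalues in an arbitrary order; equal characteristic polynomials
    make them a permutation of [lam], and permuting the rows of the unitary restores the prescribed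
    order. *)
Lemma hermitian_diag N (rho : 'M[C]_N) (lam : 'I_N -> R) : Defs.hermitian rho ->
  char_poly rho = \prod_(j < N) ('X - ((lam j)%:C)%C%:P) ->
  exists2 V : 'M[C]_N, V *m adj V = 1%:M &
    rho = adj V *m diag_mx (\row_j (lam j)%:C%C) *m V.
Proof.
move=> rhoH charE.
have adjE p q (A : 'M[C]_(p, q)) : map_mx Num.conj A^T = adj A by rewrite /adj map_trmx.
have /orthomx_spectralP : rho \is normalmx.
  by apply/normalmxP; rewrite adjE [adj rho]rhoH.
set P := spectralmx rho; set d := spectral_diag rho.
have Pu : P \is unitarymx by exact: spectral_unitarymx.
have P1 : P *m adj P = 1%:M by rewrite -adjE; apply/unitarymxP.
rewrite invmx_unitary // adjE => rhoE.
have char_d : char_poly rho = \prod_(j < N) ('X - (d 0 j)%:P).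
  have -> : char_poly rho = char_poly (diag_mx d).
    rewrite /char_poly /char_poly_mx [in LHS]rhoE !map_mxM /=.
    have P1X : map_mx polyC (adj P) *m map_mx polyC P = 1%:M.
      by rewrite -map_mxM /= (mulmx1C P1) map_mx1.
    have -> : 'X%:M = map_mx polyC (adj P) *m 'X%:M *m map_mx polyC P :> 'M_N.
      by rewrite scalar_mxC -mulmxA P1X mulmx1.
    rewrite -mulmxBl -mulmxBr !det_mulmx mulrAC -det_mulmx P1X det1 mul1r.
    by rewrite scalar_mxC -mulmxA P1X mulmx1.
  rewrite char_poly_trig ?diag_mx_is_trig //.
  by apply: eq_bigr => j _; rewrite !mxE eqxx.
have : perm_eq [tuple (lam j)%:C%C | j < N] [tuple d 0 j | j < N].
  apply: prod_XsubC_perm; rewrite !big_tuple.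
  under eq_bigr do rewrite tnth_mktuple.
  by under [RHS]eq_bigr do rewrite tnth_mktuple; rewrite -charE char_d.
case/tuple_permP => sg lam_d.
have lamE j : (lam j)%:C%C = d 0 (sg j).
  have := congr1 (fun t => nth 0 t j) lam_d.
  by rewrite -!tnth_nth !tnth_mktuple.
exists (rowsub sg P).
  by apply: rowsub_coisometry => //; apply: perm_inj.
rewrite [LHS]rhoE; apply/matrixP => a b.
rewrite [LHS]mxE [RHS]mxE (reindex_inj (@perm_inj _ sg)) /=; apply: eq_bigr => j _.
by rewrite !mul_mx_diag !mxE lamE.
Qed.

(** Each entry lies in [0, 1], where x <= x^a for such exponents. *)
Lemma powsum_ge1 m (a : R) (x : 'I_m -> R) : 0 <= a <= 1 ->
  (forall i, 0 <= x i) /\ \sum_i x i = 1 -> 1 <= powsum a x.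
Proof.
move=> /andP[a0 a1] [x_ge0 x1].
rewrite -[leLHS]x1 (bigID (fun i => x i != 0)) /= [X in _ + X]big1 ?addr0; last first.
  by move=> i /negPn/eqP.
apply: ler_sum => i xi; have x_gt0 : 0 < x i by rewrite lt_neqAle eq_sym xi x_ge0.
rewrite -{1}[x i]powRr1 //; apply: ger_powR => //; rewrite x_gt0 /= -x1.
by rewrite (bigD1 i) //= lerDl sumr_ge0.
Qed.

Section Majorization.
Context {N : nat} (U rho : 'M[C]_N) (lam : 'I_N -> R).
Hypothesis U_unitary : unitary U.
Hypothesis rho_density : density_matrix rho.
Hypothesis rho_lam : eigenvalues_sorted rho lam.

Let p := diag_probs rho.
Let q := diag_probs (adj U *m rho *m U).

Definition joint_probs (x : 'I_(N + N)) : R :=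
  match split x with inl i => p i | inr i => q i end.

Let U_isom : adj U *m U = 1%:M := mulmx1C U_unitary.

Lemma joint_probs_frame x :
  joint_probs x = complex.Re ((adj (frame U) *m rho *m frame U) x x).
Proof.
have -> : adj (frame U) *m rho *m frame U =
    block_mx rho (rho *m U) (adj U *m rho) (adj U *m rho *m U).
  have -> : adj (frame U) = col_mx 1%:M (adj U).
    by rewrite /adj map_row_mx tr_row_mx map_mx1 trmx1.
  by rewrite mul_col_mx mul_col_row mul1mx !mulmx1.
rewrite /joint_probs; case: split_ordP => i ->; first by rewrite block_mxEul.
by rewrite block_mxEdr.
Qed.

Lemma lam_ge0 i : 0 <= lam i.
Proof.
have [rhoH rho_psd _] := rho_density; have [charE _] := rho_lam.
have [V V1 rhoE] := hermitian_diag _ _ _ rhoH charE.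
have := rho_psd (adj (row i V)); rewrite adjK.
have -> : (row i V *m rho *m adj (row i V)) 0 0 = (V *m rho *m adj V) i i.
  by rewrite -row_mul !mxE; apply: eq_bigr => x _; rewrite !mxE.
rewrite rhoE !mulmxA V1 mul1mx -mulmxA V1 mulmx1 !mxE eqxx mulr1n.
by rewrite lecR.
Qed.

Lemma sum_lam : \sum_i lam i = 1.
Proof.
have [rhoH _ tr1] := rho_density; have [charE _] := rho_lam.
have [V V1 rhoE] := hermitian_diag _ _ _ rhoH charE.
move: tr1; rewrite rhoE mxtrace_mulC mulmxA V1 mul1mx mxtrace_diag.
move/(congr1 (@complex.Re R)); rewrite Re_sum /= => <-.
by apply: eq_bigr => i _; rewrite mxE.
Qed.

Lemma joint_probs_diag : exists2 V : 'M[C]_N, V *m adj V = 1%:M &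
  forall x, joint_probs x = \sum_j lam j * nsq ((V *m frame U) j x).
Proof.
have [rhoH _ _] := rho_density; have [charE _] := rho_lam.
have [V V1 rhoE] := hermitian_diag _ _ _ rhoH charE; exists V => // x.
rewrite joint_probs_frame rhoE; set A := frame U.
have -> : adj A *m (adj V *m diag_mx (\row_j (lam j)%:C%C) *m V) *m A =
    adj (V *m A) *m diag_mx (\row_j (lam j)%:C%C) *m (V *m A).
  by rewrite adjM !mulmxA.
rewrite mxE Re_sum; apply: eq_bigr => j _.
rewrite mul_mx_diag !mxE; set z := \sum_(_ < _) _.
by case: z => a b; rewrite /nsq /=; ring.
Qed.

Lemma joint_probs_ge0 x : 0 <= joint_probs x.
Proof.
have [V _ ->] := joint_probs_diag.
by apply: sumr_ge0 => j _; rewrite mulr_ge0 ?lam_ge0 ?nsq_ge0.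
Qed.

(** Each row of [V *m frame U] has squared norm 2, because V (1 + U U†) V† = 2. *)
Lemma sum_joint_probs : \sum_x joint_probs x = 2.
Proof.
have [V V1 E] := joint_probs_diag.
under eq_bigr do rewrite E.
rewrite exchange_big /=.
have row2 j : \sum_x nsq ((V *m frame U) j x) = 2.
  rewrite -Re_diag_cogram.
  have -> : frame U = row_mx 1%:M U by [].
  rewrite adjM mulmxA -(mulmxA V).
  have -> : adj (row_mx 1%:M U) = col_mx 1%:M (adj U).
    by rewrite /adj map_row_mx tr_row_mx map_mx1 trmx1.
  rewrite mul_row_col mulmx1 U_unitary mulmxDr mulmx1 mulmxDl V1 !mxE eqxx.
  by rewrite ReD.
under eq_bigr => j _ do rewrite -mulr_sumr row2.
by rewrite -mulr_suml sum_lam mul1r.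
Qed.

Lemma joint_probs_le (S : {set 'I_(N + N)}) :
  \sum_(x in S) joint_probs x <= S_coef U lam #|S|.
Proof.
have [V V1 E] := joint_probs_diag; have [_ lam_sorted] := rho_lam.
(* Row masses are extended by 0 to all naturals, the index type of [abel_sum]. *)
pose h j := if insub j is Some i then \sum_(x in S) nsq ((V *m frame U) i x) else 0.
have hE (i : 'I_N) : h i = \sum_(x in S) nsq ((V *m frame U) i x).
  by rewrite /h valK.
have -> : \sum_(x in S) joint_probs x = \sum_(j < N) lamx lam j.+1 * h j.
  under eq_bigr do rewrite E.
  by rewrite exchange_big; apply: eq_bigr => j _; rewrite lamx_ord hE mulr_sumr.
rewrite (abel_sum _ (fun j => lamx lam j.+1)) lamx_ge // mul0r addr0 S_coef_abel.
apply: ler_sum => j _; apply: ler_wpM2l.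
  by apply: lamx_decr => //; exact: lam_ge0.
have := ky_fan_le U U_isom V S j.+1 V1 (ltn_ord j).
rewrite (big_ord_narrow (ltn_ord j)); move/(le_trans _); apply.
by rewrite le_eqVlt; apply/orP; left; apply/eqP; apply: eq_bigr => i _; rewrite -hE.
Qed.

Lemma W_vec_ge0 i : 0 <= W_vec U lam i.
Proof.
have [_ lam_sorted] := rho_lam.
by rewrite subr_ge0 S_coef_mono //; exact: lam_ge0.
Qed.

Lemma W_vec_karamata (phi dphi : R -> R) :
  (forall a b, 0 < a -> 0 <= b -> phi b <= phi a + dphi a * (b - a)) -> phi 0 = 0 ->
  \sum_i phi (W_vec U lam i) <= \sum_i phi (p i) + \sum_i phi (q i).
Proof.
move=> tangent phi0.
pose v j := S_coef U lam j.+1 - S_coef U lam j.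
have sum_v k : \sum_(j < k) v j = S_coef U lam k.
  by rewrite -(big_mkord xpredT v) telescope_sumr // [S_coef _ _ 0]/S_coef /= subr0.
have -> : \sum_i phi (p i) + \sum_i phi (q i) = \sum_x phi (joint_probs x).
  rewrite big_split_ord /=; congr (_ + _); apply: eq_bigr => i _.
    by rewrite /joint_probs (unsplitK (inl i)).
  by rewrite /joint_probs (unsplitK (inr i)).
have := karamata_tangent R phi dphi 'I_(N + N) joint_probs v tangent phi0 joint_probs_ge0.
rewrite card_ord; apply.
- by move=> j jN; have := W_vec_ge0 (Ordinal jN).
- by move=> S; rewrite sum_v joint_probs_le.
- by rewrite sum_joint_probs sum_v S_coef_total // sum_lam mulr1.
Qed.

Lemma p_prob : (forall i, 0 <= p i) /\ \sum_i p i = 1.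
Proof.
have [_ _ tr1] := rho_density; split=> [i|].
  by have := joint_probs_ge0 (lshift N i); rewrite /joint_probs (unsplitK (inl i)).
by rewrite -[RHS]/(complex.Re (1 : C)) -tr1 Re_sum.
Qed.

Lemma q_prob : (forall i, 0 <= q i) /\ \sum_i q i = 1.
Proof.
have [_ _ tr1] := rho_density; split=> [i|].
  by have := joint_probs_ge0 (rshift N i); rewrite /joint_probs (unsplitK (inr i)).
rewrite -[RHS]/(complex.Re (1 : C)) -tr1 -[rho in RHS]mulmx1 -U_unitary mulmxA.
by rewrite [in RHS]mxtrace_mulC mulmxA /q /diag_probs -Re_sum.
Qed.

End Majorization.
End Assembly.

Lemma shannonE (R : realType) m (x : 'I_m -> R) : shannon x = \sum_i ent_term (x i).
Proof. by rewrite /shannon -sumrN big_mkcond. Qed.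

Lemma powsumE (R : realType) m (a : R) (x : 'I_m -> R) :
  powsum a x = \sum_i pow_term a (x i).
Proof. by rewrite /powsum big_mkcond. Qed.

Theorem theorem2 (R : realType) (N : nat) (hN : (0 < N)%N)
  (U rho : 'M[R[i]]_N) (lam : 'I_N -> R) :
  unitary U -> density_matrix rho -> eigenvalues_sorted rho lam ->
  let p := diag_probs rho in
  let q := diag_probs (adj U *m rho *m U) in
  let W := W_vec U lam in
  [/\ shannon p + shannon q >= shannon W,
      (forall a : R, 0 <= a < 1 ->
         renyi a p + renyi a q >= (1 - a)^-1 * ln (powsum a W - 1)) &
      (forall a : R, 0 <= a -> a != 1 ->
         tsallis a p + tsallis a q >= (1 - a)^-1 * (powsum a W - 2))].
Proof.
move=> U_unitary rho_density rho_lam p q W.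
have maj := W_vec_karamata U rho lam U_unitary rho_density rho_lam.
have powsum_le a : 0 <= a <= 1 -> powsum a W <= powsum a p + powsum a q.
  move=> a01; rewrite !powsumE; apply: (maj _ (fun x => a * x `^ a / x)).
    by move=> x w; apply: pow_term_tangent_lt1.
  by rewrite /pow_term eqxx.
have powsum_ge a : 1 <= a -> powsum a p + powsum a q <= powsum a W.
  move=> a1; rewrite !powsumE -lerN2 opprD -!sumrN.
  apply: (maj (fun x => - pow_term a x) (fun x => - (a * x `^ a / x))).
    by move=> x w; apply: pow_term_tangent_gt1.
  by rewrite /pow_term eqxx oppr0.
split.
- rewrite !shannonE; apply: (maj _ (fun x => - (ln x + 1))); first exact: ent_term_tangent.
  by rewrite /ent_term eqxx.
- move=> a /andP[a0 a1]; have a01 : 0 <= a <= 1 by rewrite a0 ltW.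
  have P1 : 1 <= powsum a p by apply: powsum_ge1 => //; apply: (p_prob U rho lam).
  have Q1 : 1 <= powsum a q by apply: powsum_ge1 => //; apply: (q_prob U rho lam).
  have P0 : 0 < powsum a p by apply: lt_le_trans P1.
  have Q0 : 0 < powsum a q by apply: lt_le_trans Q1.
  rewrite /renyi -mulrDr ler_wpM2l //; first by rewrite invr_ge0 subr_ge0 ltW.
  rewrite -lnM ?posrE //; have le_PQ := powsum_le a a01.
  have [W0|W0] := leP (powsum a W - 1) 0.
    (* Here [ln] takes its default value 0, and the left side is nonnegative because both power sums
       are at least 1. *)
    by rewrite (ln0 W0) ln_ge0 // -[leLHS]mulr1 ler_pM.
  rewrite ler_ln ?posrE ?mulr_gt0 //.
  (* This product gives P + Q - 1 <= P Q, which passes from the sum bound to the logarithm of the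
     product. *)
  have : 0 <= (powsum a p - 1) * (powsum a q - 1) by rewrite mulr_ge0 ?subr_ge0.
  by rewrite mulrBl !mulrBr; lra.
- move=> a a0 a1; rewrite /tsallis -mulrDr.
  have -> : powsum a p - 1 + (powsum a q - 1) = powsum a p + powsum a q - 2 by ring.
  have [lt1|lt1] := ltP a 1.
    rewrite ler_wpM2l ?lerD2r //; first by rewrite invr_ge0 subr_ge0 ltW.
    by apply: powsum_le; rewrite a0 ltW.
  (* For a > 1 the prefactor is negative, so the reversed comparison of power sums is what is
     needed. *)
  rewrite ler_wnM2l ?invr_le0 ?subr_le0 // lerD2r.
  exact: powsum_ge.
Qed.
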